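(* Let $q$ be a prime power, $m,k,t$ positive integers with $k<m$, $s\in\{1,\ldots,m\}$ with $\gcd(s,m)=1$, and let $\{\alpha_1,\ldots,\alpha_t\}$, $\{\beta_1,\ldots,\beta_t\}$ be subsets of $\mathbb{F}_{q^m}^*$ each of whose elements have pairwise distinct norms over $\mathbb{F}_q$. For $i,j\in\{1,\ldots,t\}$ let \[ \mathcal{U}_i=\{(x,\mathrm{N}_s^1(\alpha_i)x^{q^s},\ldots,\mathrm{N}_s^{k-1}(\alpha_i)x^{q^{s(k-1)}}):x\in\mathbb{F}_{q^m}\},\quad \mathcal{V}_j=\{(y,\mathrm{N}_s^1(\beta_j)y^{q^s},\ldots,\mathrm{N}_s^{k-1}(\beta_j)y^{q^{s(k-1)}}):y\in\mathbb{F}_{q^m}\}. \] Then $(\mathcal{U}_1,\ldots,\mathcal{U}_t)$ and $(\mathcal{V}_1,\ldots,\mathcal{V}_t)$ are equivalent if and only if there exists $\xi\in\mathbb{F}_q^*$ such that $\{\mathrm{N}_s(\beta_j):j=1,\ldots,t\}=\{\xi\,\mathrm{N}_s(\alpha_i):i=1,\ldots,t\}$.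
   Context: For $\alpha\in\mathbb{F}_{q^m}$: $\mathrm{N}_s(\alpha)=\prod_{i=0}^{m-1}\alpha^{q^{si}}\in\mathbb{F}_q$, $\mathrm{N}_s^0(\alpha)=1$, $\mathrm{N}_s^j(\alpha)=\prod_{i=0}^{j-1}\alpha^{q^{si}}$ for $j\ge1$. Two $t$-tuples $(\mathcal{U}_1,\ldots,\mathcal{U}_t)$, $(\mathcal{V}_1,\ldots,\mathcal{V}_t)$ of $\mathbb{F}_q$-subspaces of $\mathbb{F}_{q^m}^k$ are equivalent if there exist $A\in\mathrm{GL}(k,q^m)$, $\gamma_1,\ldots,\gamma_t\in\mathbb{F}_{q^m}^*$ and a permutation $\sigma$ of $\{1,\ldots,t\}$ with $\mathcal{U}_i=\{\gamma_iAv:v\in\mathcal{V}_{\sigma(i)}\}$ for every $i$ (vectors as columns; the same $A$ for all $i$).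
   Formalization: The formal theorem assumes k ≥ 2: for k = 1 all U_i and V_j equal F_{q^m}, so the tuples are always equivalent, yet the norm condition can fail (q = 5, m = 2, t = 2, norms {1,2} versus {1,4}). *)

(* Defs.v *)
From HB Require Import structures.
From mathcomp Require Import all_boot all_order all_fingroup all_algebra all_solvable all_field.
Set Implicit Arguments.
Unset Strict Implicit.
Unset Printing Implicit Defensive.
Import GRing.Theory.
Local Open Scope ring_scope.

Section Defs.
Variables (F : finFieldType) (L : splittingFieldType F).
Implicit Types (s j k t : nat) (a x : L).

(* N_s^j(a), with q = #|F|; the empty product gives N_s^0(a) = 1. *)
Definition truncN s j a : L := \prod_(i < j) a ^+ (#|F| ^ (s * i)).

Definition Ns s a : L := truncN s (\dim {:L}) a.

Definition skew_vec s k a x : {ffun 'I_k -> L} :=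
  [ffun j : 'I_k => truncN s j a * x ^+ (#|F| ^ (s * j))].

Lemma frobenius_linear n (c : F) x y :
  (c *: x + y) ^+ (#|F| ^ n) = c *: x ^+ (#|F| ^ n) + y ^+ (#|F| ^ n).
Proof.
have [p pr_p chFp] := finPcharP F.
have chLp : p \in [pchar L] by rewrite pchar_lalg.
have pF : p.-nat #|F|.
  have /abelem_pgroup := fin_ring_pchar_abelem chFp.
  by rewrite /pgroup cardsT.
rewrite exprDn_pchar; last first.
  by rewrite pnatX (eq_pnat _ (pcharf_eq chLp)) pF.
rewrite exprZn; congr (_ *: _ + _).
by elim: n => [|n IHn]; rewrite ?expr1 // expnS exprM expf_card.
Qed.

Fact skew_vec_linear s k a : linear (@skew_vec s k a).
Proof.
move=> c x y; apply/ffunP=> j; rewrite !ffunE frobenius_linear mulrDr.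
by rewrite scalerAr.
Qed.

HB.instance Definition _ s k a :=
  GRing.isLinear.Build F L {ffun 'I_k -> L} _ (@skew_vec s k a)
    (@skew_vec_linear s k a).

(* The scalars of [{ffun 'I_k -> L}] are those of [F], so its subspaces are the
   F-subspaces of L^k. *)
Definition skew_space s k a : {vspace {ffun 'I_k -> L}} :=
  limg (linfun (@skew_vec s k a)).

Lemma skew_spaceP s k a (u : {ffun 'I_k -> L}) :
  reflect (exists x, u = skew_vec s k a x) (u \in skew_space s k a).
Proof.
apply: (iffP memv_imgP) => [[x _ ->]|[x ->]]; exists x; rewrite ?lfunE //.
exact: memvf.
Qed.

Definition mulmx_ffun k (A : 'M[L]_k) (v : {ffun 'I_k -> L}) :
  {ffun 'I_k -> L} := [ffun i => \sum_j A i j * v j].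

Definition tuples_equivalent k t (U V : 'I_t -> {vspace {ffun 'I_k -> L}}) :
    Prop :=
  exists (A : 'M[L]_k) (gamma : 'I_t -> L) (sigma : {perm 'I_t}),
    [/\ A \in unitmx,
        forall i, gamma i != 0 &
        forall i (u : {ffun 'I_k -> L}),
          u \in U i <->
          exists2 v, v \in V (sigma i) &
            u = [ffun l => gamma i * mulmx_ffun A v l]].

End Defs.

(* Main.v *)
(** Write [theta x = x ^+ (q ^ s)]; as [s] is prime to [m], it generates the
    Galois group of [L] over [F], and [N_s] is the usual norm.

    If [U_i = gamma A V_(sigma i)], every [y] has an [x] such that, for all [l],
    [N^l(alpha) theta^l x = gamma * \sum_j A_lj N^j(beta) theta^j y].
    Row [0] expresses [x] through [y]; substituting it into row [l] and
    comparing coefficients of powers of [theta] (Dedekind) gives, from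
    [theta^k] in row [k - d], that [A_0d = 0] for [0 < d], and from [theta] in
    row [1], that [alpha * theta (gamma A_00) = gamma A_11 beta].  Hence
    [A_00 != 0] and [N beta = N (A_00 / A_11) * N alpha], with a factor that
    does not depend on [i].

    Conversely, [xi] is the norm of [c = beta_(sigma i) / alpha_i] for any fixed
    [i], so Hilbert 90 gives
    [beta_(sigma i) = c alpha_i theta(delta_i) / delta_i] for every [i], and the
    diagonal matrix of the [N^l(c)^-1] with the scalars [delta_i] maps one tuple
    to the other. *)
Require Import Defs.
From HB Require Import structures.
From mathcomp Require Import all_boot all_order all_fingroup all_algebra all_solvable all_field.
Import GRing.Theory.
Local Open Scope ring_scope.

Section FrobeniusPowers.

Variables (F : finFieldType) (L : splittingFieldType F).
Implicit Types (s j k : nat) (a b x y : L).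

Lemma exprX_card_comp s i j x :
  (x ^+ (#|F| ^ (s * i))) ^+ (#|F| ^ (s * j)) = x ^+ (#|F| ^ (s * (i + j))).
Proof. by rewrite -exprM -expnD -mulnDr. Qed.

Lemma expr_card_sum n (I : finType) (f : I -> L) :
  (\sum_i f i) ^+ (#|F| ^ n) = \sum_i f i ^+ (#|F| ^ n).
Proof.
apply: (big_morph (fun x => x ^+ (#|F| ^ n))) => [x y|].
  by have := frobenius_linear n 1 x y; rewrite !scale1r.
by rewrite expr0n expn_eq0 -leqn0 leqNgt (cardD1 0) inE.
Qed.

Lemma gal_expg_card (g : gal_of {:L}) s j x :
  (forall y, g y = y ^+ (#|F| ^ s)) -> (g ^+ j)%g x = x ^+ (#|F| ^ (s * j)).
Proof.
move=> gE; elim: j => [|j IHj] in x *; first by rewrite gal_id muln0 expr1.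
by rewrite expgSr galM ?memvf // IHj gE -exprM -expnD -mulnSr.
Qed.

Lemma card_gal_full : #|'Gal({:L} / 1)%g| = \dim {:L}.
Proof.
by rewrite -(galois_dim (finField_galois (subvf 1))) dimv1 divn1.
Qed.

(** The Galois group is cyclic of order [\dim {:L}], generated by the [#|F|]-power map, so a power
    of that map with exponent prime to the order generates it too. *)
Lemma gal_generator_expr_card s : coprime s (\dim {:L}) ->
  exists2 g : gal_of {:L}, generator 'Gal({:L} / 1) g &
    forall x, g x = x ^+ (#|F| ^ s).
Proof.
move=> co_s; have [h hgen hE] := finField_galois_generator (sub1v {:L}%AS).
have hE1 y : h y = y ^+ (#|F| ^ 1) by rewrite hE ?memvf //= dimv1.
have defG := eqP hgen; exists (h ^+ s)%g => [|x].
  by rewrite defG generator_coprime orderE -defG card_gal_full coprime_sym.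
by rewrite (gal_expg_card _ 1) ?mul1n.
Qed.

Lemma order_gal_generator (g : gal_of {:L}) :
  generator 'Gal({:L} / 1) g -> #[g]%g = \dim {:L}.
Proof. by move=> /eqP defG; rewrite orderE -defG card_gal_full. Qed.

(** The powers of the generator [g] run once through the Galois group, so both sides have the same
    factors in a different order. *)
Lemma Ns_galNorm s a : coprime s (\dim {:L}) -> Ns s a = galNorm 1 {:L} a.
Proof.
move=> co_s; have [g gen_g gE] := gal_generator_expr_card s co_s.
rewrite /galNorm (eqP gen_g) /Ns /truncN -(order_gal_generator g gen_g).
have -> : <[g]>%g = [set (g ^+ i)%g | i : 'I_#[g]%g].
  apply/setP=> x; apply/idP/imsetP => [/cyclePmin[i lti ->]|[i _ ->]].
    by exists (Ordinal lti).
  exact: mem_cycle.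
rewrite big_imset /= => [|i j _ _ /eqP]; last by rewrite eq_expg_ord // => /eqP.
by apply: eq_big => // i _; rewrite (gal_expg_card _ s).
Qed.

Lemma galNorm_expr_card n a : galNorm 1 {:L} (a ^+ (#|F| ^ n)) = galNorm 1 {:L} a.
Proof.
have [g gen_g gE] := gal_generator_expr_card 1 (coprime1n _).
rewrite -[n]mul1n -(gal_expg_card g) // galNorm_gal ?memvf // groupX //.
by move: (cycle_id g); rewrite -(eqP gen_g).
Qed.

(** Dedekind independence of automorphisms. As [g] has order [\dim {:L}], exponents count only
    modulo the degree; this matters for sums of two indices, which may exceed it. *)
Lemma frobenius_coef_eq s (I J : finType) (h : I -> nat) (h' : J -> nat)
    (c : I -> L) (d : J -> L) : coprime s (\dim {:L}) ->
    (forall y, \sum_i c i * y ^+ (#|F| ^ (s * h i)) =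
               \sum_j d j * y ^+ (#|F| ^ (s * h' j))) ->
  forall e, \sum_(i | h i == e %[mod \dim {:L}]) c i =
            \sum_(j | h' j == e %[mod \dim {:L}]) d j.
Proof.
move=> co_s eq_cd e; have [g gen_g gE] := gal_generator_expr_card s co_s.
(* [f x] is the total coefficient of the automorphism [x] in the difference of the two sides. *)
pose f (x : gal_of {:L}) := \sum_(i | (g ^+ h i)%g == x) c i - \sum_(j | (g ^+ h' j)%g == x) d j.
have f0 : f (g ^+ e)%g = 0.
  apply: (@gal_independent _ _ _ predT f) => // y _.
  under eq_bigr do rewrite mulrBl !mulr_suml.
  rewrite sumrB; apply/eqP; rewrite subr_eq0; apply/eqP.
  have := eq_cd y.
  rewrite (partition_big (fun i => g ^+ h i)%g predT) //=.
  rewrite [RHS](partition_big (fun j : J => g ^+ h' j)%g predT) //= => eq_y.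
  transitivity (\sum_(x : gal_of {:L}) \sum_(i | (g ^+ h i)%g == x)
      c i * y ^+ (#|F| ^ (s * h i))); last rewrite eq_y;
  apply: eq_bigr => x _; apply: eq_bigr => i /eqP <-.
    by rewrite (gal_expg_card _ s).
  by rewrite (gal_expg_card _ s).
apply/eqP; rewrite -subr_eq0 -(order_gal_generator g gen_g) -[X in _ == X]f0 /f.
apply/eqP; congr (_ - _); apply: eq_bigl => i.
  by rewrite eq_expg_mod_order.
by rewrite eq_expg_mod_order.
Qed.

Lemma truncN_neq0 s j a : a != 0 -> truncN s j a != 0.
Proof. by move=> nz_a; apply/prodf_neq0 => i _; rewrite expf_neq0. Qed.

Lemma truncN0 s a : truncN s 0 a = 1.
Proof. exact: big_ord0. Qed.

Lemma truncN1 s a : truncN s 1 a = a.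
Proof. by rewrite /truncN big_ord1 muln0 expr1. Qed.

Lemma truncNM s j a b : truncN s j (a * b) = truncN s j a * truncN s j b.
Proof. by rewrite /truncN -big_split; apply: eq_bigr => i _; rewrite exprMn. Qed.

(** The product telescopes. *)
Lemma truncN_coboundary s j b : b != 0 ->
  truncN s j (b ^+ (#|F| ^ s) / b) = b ^+ (#|F| ^ (s * j)) / b.
Proof.
move=> nz_b; elim: j => [|j IHj].
  by rewrite truncN0 muln0 expr1 divff.
rewrite /truncN big_ord_recr /= -/(truncN s j _) IHj expr_div_n.
rewrite -[in b ^+ (_ ^ s)](muln1 s) exprX_card_comp add1n.
by rewrite mulrC mulrA divfK // expf_neq0.
Qed.

Lemma galNorm_of_equivalence s k (A : 'M[L]_k) (i0 i1 : 'I_k) a b c :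
    coprime s (\dim {:L}) -> (k < \dim {:L})%N -> i0 = 0%N :> nat ->
    i1 = 1%N :> nat -> A \in unitmx -> a != 0 -> b != 0 -> c != 0 ->
    (forall y, [ffun l => c * mulmx_ffun A (skew_vec s k b y) l]
                 \in skew_space s k a) ->
  [/\ A i0 i0 != 0, A i1 i1 != 0 &
      galNorm 1 {:L} b = galNorm 1 {:L} (A i0 i0 / A i1 i1) * galNorm 1 {:L} a].
Proof.
set m := \dim {:L} => co_s ltkm i0E i1E uA nz_a nz_b nz_c sub.
pose th n x := x ^+ (#|F| ^ (s * n)).
(* Coordinate [i0] of the image is the parameter [x] itself; the left side is coordinate [l] with
   this value of [x] inserted. *)
have rowE (l : 'I_k) y :
    \sum_j (truncN s l a * th l (c * A i0 j * truncN s j b)) * th (j + l)%N y =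
    \sum_j (c * A l j * truncN s j b) * th j y.
  have /skew_spaceP[x /ffunP Dx] := sub y.
  have := Dx i0; rewrite !ffunE i0E truncN0 mul1r muln0 expr1 => Dx0.
  have := Dx l; rewrite !ffunE mulr_sumr => Dxl.
  under [RHS]eq_bigr do rewrite -!mulrA.
  under [RHS]eq_bigr => j _ do rewrite -[truncN s j b * _](ffunE
    (fun j : 'I_k => truncN s j b * y ^+ (#|F| ^ (s * j)))).
  rewrite [RHS]Dxl -Dx0 mulr_sumr expr_card_sum mulr_sumr; apply: eq_bigr => j _.
  by rewrite ffunE /th -exprX_card_comp -mulrA -exprMn !mulrA.
have coefE (l : 'I_k) e := frobenius_coef_eq s _ _ _ _ _ _ co_s (rowE l) e.
have ltm (j : 'I_k) : (j < m)%N := ltn_trans (ltn_ord j) ltkm.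
have nzN j x : x != 0 -> truncN s j x != 0 by apply: truncN_neq0.
have row0 (d : 'I_k) : d != i0 -> A i0 d = 0.
  rewrite -val_eqE /= i0E -lt0n => d_gt0.
  (* In row [k - d] the exponent [k] arises on the left from [j = d] alone, and never on the right,
     where all exponents are below [k < m]. *)
  have ltl : (k - d < k)%N by rewrite ltn_subrL d_gt0 (leq_ltn_trans _ (ltn_ord d)).
  have := coefE (Ordinal ltl) k; rewrite [RHS]big_pred0 => [|j]; last first.
    by rewrite !modn_small //= ltn_eqF.
  rewrite (big_pred1 d) => [/eqP|j]; last first.
    rewrite /= -[X in _ == X %[mod _]](subnKC (ltnW (ltn_ord d))).
    by rewrite eqn_modDr !modn_small.
  rewrite mulf_eq0 expf_eq0 !mulf_eq0 (negPf nz_c) !(negPf (nzN _ _ _)) //.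
  by rewrite /= orbF; case/andP=> _ /eqP.
have := coefE i1 1%N; rewrite (big_pred1 i0) => [|j]; last first.
  by rewrite i1E -[X in _ == X %[mod _]]add0n eqn_modDr -i0E !modn_small.
rewrite (big_pred1 i1) => [|j]; last first.
  by rewrite -[X in _ == X %[mod _]]i1E !modn_small.
rewrite i0E i1E truncN1 truncN0 mulr1 truncN1 => key.
have nz00 : A i0 i0 != 0.
  (* Otherwise row [i0] of [A] would vanish altogether. *)
  apply/eqP=> A00; move: uA.
  rewrite unitmxE (expand_det_row _ i0) big1 ?unitr0 // => j _.
  by have [->|/row0->] := eqVneq j i0; rewrite ?A00 mul0r.
have nz11 : A i1 i1 != 0.
  apply/eqP=> A11; move/eqP: key.
  rewrite A11 mulr0 mul0r mulf_eq0 (negPf nz_a) expf_eq0.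
  by rewrite mulf_eq0 (negPf nz_c) (negPf nz00) andbF.
(* The norm does not see the power map in [key], so the norm of [c] cancels and the factor left
   depends on [A] only. *)
split=> //; have := congr1 (galNorm 1 {:L}) key.
rewrite !galNormM galNorm_expr_card !galNormM galNormV => keyN.
have nzc : galNorm 1 {:L} c != 0 by rewrite galNorm_eq0.
have nz1 : galNorm 1 {:L} (A i1 i1) != 0 by rewrite galNorm_eq0.
apply: (mulfI nz1); apply: (mulfI nzc); rewrite !mulrA -keyN.
by rewrite [_ / _]mulrAC mulfK // mulrC.
Qed.

End FrobeniusPowers.

Theorem theorem5p4 (F : finFieldType) (L : splittingFieldType F)
    (m k t s : nat) (alpha beta : 'I_t -> L)
    (hm : \dim {:L} = m) (hk : (1 < k)%N) (hkm : (k < m)%N) (ht : (0 < t)%N)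
    (hs : (1 <= s <= m)%N) (hsm : coprime s m)
    (alpha0 : forall i, alpha i != 0) (beta0 : forall j, beta j != 0)
    (alphaN : injective (fun i => galNorm 1 {:L} (alpha i)))
    (betaN : injective (fun j => galNorm 1 {:L} (beta j))) :
  tuples_equivalent (fun i => skew_space s k (alpha i))
                    (fun j => skew_space s k (beta j)) <->
  exists2 xi : F, xi != 0 &
    [seq Ns s (beta j) | j : 'I_t] =i [seq xi *: Ns s (alpha i) | i : 'I_t].
Proof.
subst m; have NsE := Ns_galNorm _ _ s.
split=> [[A [gamma [sigma [uA nz_gamma equiv]]]] | [xi nz_xi eq_norms]].
  pose i0 := Ordinal (ltnW hk); pose i1 := Ordinal hk.
  have normE i := galNorm_of_equivalence _ _ s k A i0 i1 _ _ _ hsm hkm erefl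
    erefl uA (alpha0 i) (beta0 (sigma i)) (nz_gamma i).
  have {}normE i : [/\ A i0 i0 != 0, A i1 i1 != 0 &
      galNorm 1 {:L} (beta (sigma i)) =
      galNorm 1 {:L} (A i0 i0 / A i1 i1) * galNorm 1 {:L} (alpha i)].
    apply: normE => y; apply/equiv; exists (skew_vec s k (beta (sigma i)) y) => //.
    by apply/skew_spaceP; exists y.
  have [nz00 nz11 _] := normE (Ordinal ht).
  have /vlineP[xi Dxi] : galNorm 1 {:L} (A i0 i0 / A i1 i1) \in 1%VS.
    by apply: mem_galNorm (finField_galois (subvf 1)) (memvf _).
  exists xi => [|z].
    apply: contra_eqN Dxi => /eqP->.
    by rewrite scale0r galNorm_eq0 mulf_neq0 ?invr_eq0.
  have eqN i : Ns s (beta (sigma i)) = xi *: Ns s (alpha i).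
    by have [_ _] := normE i; rewrite !NsE // Dxi -scalerAl mul1r.
  apply/codomP/codomP => [[j ->]|[i ->]].
    by exists (sigma^-1%g j); rewrite -eqN permKV.
  by exists (sigma i); rewrite eqN.
have /fin_all_exists[f fE] i : exists j, Ns s (beta j) = xi *: Ns s (alpha i).
  have : xi *: Ns s (alpha i) \in [seq Ns s (beta j) | j : 'I_t].
    by rewrite eq_norms; apply/codomP; exists i.
  by case/codomP=> j ->; exists j.
(* Distinct norms of the [alpha i] make [f] injective, hence a permutation of the finite index
   set. *)
have inj_f : injective f.
  move=> i i' eq_f; apply: alphaN; rewrite -!NsE //.
  by apply: (scalerI nz_xi); rewrite -!fE eq_f.
pose i0 := Ordinal ht; pose c := beta (f i0) / alpha i0.
have nz_c : c != 0 by rewrite mulf_neq0 ?invr_eq0.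
have Nc : galNorm 1 {:L} c = xi%:A.
  rewrite galNormM galNormV -!NsE // fE -scalerAl divff // NsE //.
  by rewrite galNorm_eq0.
have [g gen_g gE] := gal_generator_expr_card _ _ s hsm.
have /fin_all_exists[delta deltaP] i : exists d, d != 0 /\
    beta (f i) = c * alpha i * (d ^+ (#|F| ^ s) / d).
  have nz_ca : c * alpha i != 0 by rewrite mulf_neq0.
  have /eqP/(Hilbert's_theorem_90 gen_g (memvf _))[b [_ nz_b] Db] :
      galNorm 1 {:L} (beta (f i) / (c * alpha i)) = 1.
    rewrite galNormM galNormV galNormM Nc -!NsE // fE mulr_algl.
    by rewrite divff // scaler_eq0 negb_or nz_xi NsE // galNorm_eq0 alpha0.
  (* Hilbert 90 yields the quotient as [b / g b], with [g] in the denominator, whence the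
     inverse. *)
  exists b^-1; rewrite invr_eq0 nz_b; split=> //.
  by rewrite invrK exprVn -gE [_^-1 * b]mulrC -Db mulrC divfK.
pose D : 'rV[L]_k := \row_l (truncN s l c)^-1.
exists (diag_mx D), delta, (perm inj_f); split=> [|i|i u].
- rewrite unitmxE det_diag unitfE; apply/prodf_neq0 => l _.
  by rewrite mxE invr_eq0 truncN_neq0.
- by case: (deltaP i).
have [nz_d betaE] := deltaP i; rewrite permE.
(* The entry [l] of [D] cancels [truncN s l c], and the scalar [delta i] cancels the denominator of
   the coboundary; what remains is the parameter change from [y] to [delta i * y], a bijection. *)
have vecE y : skew_vec s k (alpha i) (delta i * y) =
    [ffun l => delta i * mulmx_ffun (diag_mx D) (skew_vec s k (beta (f i)) y) l].
  apply/ffunP=> l; rewrite !ffunE (bigD1 l) //= big1 => [|j ne_jl]; last first.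
    by rewrite !mxE eq_sym (negPf ne_jl) mulr0n mul0r.
  rewrite !mxE eqxx mulr1n addr0 !ffunE betaE truncNM truncN_coboundary // truncNM.
  rewrite exprMn -!mulrA mulKf ?truncN_neq0 //.
  by rewrite [RHS]mulrCA; congr (_ * _); rewrite [RHS]mulrCA mulVKf.
split=> [/skew_spaceP[x ->]|[v /skew_spaceP[y ->] ->]].
  exists (skew_vec s k (beta (f i)) ((delta i)^-1 * x)); last first.
    by rewrite -vecE mulVKf.
  by apply/skew_spaceP; exists ((delta i)^-1 * x).
by rewrite -vecE; apply/skew_spaceP; exists (delta i * y).
Qed.
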